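(* Let $2<p<\infty$ and $\frac1p+\frac1q=1$. Let $\bar x=(\bar t_1,\bar t_2,\dots)\in l_p\setminus\{\theta\}$ with $|\mathcal N(\bar x)|<\infty$, and let $\bar y\in l_q$ with $\bar y=J(\bar x)$, where $J:l_p\to l_q$ is the normalized duality mapping. The covering constant $\hat\alpha(J,\bar x,\bar y)$ for $J$ at the point $(\bar x,\bar y)$ satisfies $$\hat\alpha(J,\bar x,\bar y)=0.$$
   Context: $(l_p,\|\cdot\|_p)$ and $(l_q,\|\cdot\|_q)$ are the real sequence spaces, $l_p^*=l_q$, $l_q^*=l_p$, $\theta=(0,0,\dots)$, and $\langle\cdot,\cdot\rangle$ is the canonical real pairing $\sum_n a_nb_n$ of elements of $l_q$ and $l_p$. The normalized duality mapping $J:l_p\to l_q$ is given by $J(\theta)=\theta$ and, for $x=(t_1,t_2,\dots)\neq\theta$, $J(x)=\left\{\frac{|t_n|^{p-1}\mathrm{sign}(t_n)}{\|x\|_p^{p-2}}\right\}_{n=1}^\infty$. For a real sequence $x=(t_n)$, $\mathcal N(x)=\{n\in\mathbb N:t_n\ne0\}$ and $|\mathcal N(x)|$ is its cardinality. The Mordukhovich derivative (Fréchet coderivative) of $J$ at $(x,y)$, $y=J(x)$, is the set-valued map $\widehat D^*J(x,y):l_p\rightrightarrows l_q$, $$\widehat D^*J(x,y)(w)=\left\{z\in l_q:\limsup_{u\to x,\,u\in l_p}\frac{\langle z,u-x\rangle-\langle w,J(u)-J(x)\rangle}{\|u-x\|_p+\|J(u)-J(x)\|_q}\le0\right\},\quad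 w\in l_p.$$ The covering constant for $J$ at $(\bar x,\bar y)$, $\bar y=J(\bar x)$, is $$\hat\alpha(J,\bar x,\bar y)=\sup_{\eta>0}\inf\left\{\|z^*\|_q:\ z^*\in\widehat D^*J(x,y)(w^* ),\ x\in\mathbb B_{l_p}(\bar x,\eta),\ y=J(x)\in\mathbb B_{l_q}(\bar y,\eta),\ \|w^*\|_p=1\right\},$$ where $\mathbb B_X(a,\eta)$ is the closed ball in $X$ with center $a$ and radius $\eta$. *)

(* Defs.v *)
From HB Require Import structures.
From mathcomp Require Import all_boot all_order all_algebra.
From mathcomp Require Import all_classical all_reals all_analysis.

Set Implicit Arguments.
Unset Strict Implicit.
Unset Printing Implicit Defensive.
Import Order.TTheory GRing.Theory Num.Theory.
Import numFieldNormedType.Exports.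

Local Open Scope classical_set_scope.
Local Open Scope ring_scope.

(* Sequences are indexed from 0 instead of 1.  The space l_p is the L^p space
   of the counting measure on nat; every function on nat is measurable, so
   membership only says that the p-norm is finite. *)
Definition lp (R : realType) (p : R) : set (R^nat) :=
  [set x | x \in Lfun (@counting nat R) p%:E].

Definition lp_norm (R : realType) (p : R) (x : R^nat) : R :=
  fine ('N[@counting nat R]_(p%:E)[EFin \o x])%E.

Definition lp_closed_ball (R : realType) (p : R) (a : R^nat) (r : R) :
    set (R^nat) :=
  [set x | lp p x /\ lp_norm p (x - a) <= r].

(* The filter of "u -> x, u in l_p, u <> x", for the p-norm. *)
Definition lp_dnbhs (R : realType) (p : R) (x : R^nat) : set (set (R^nat)) :=
  filter_from [set e : R | 0 < e]
    (fun e => [set u | [/\ lp p u, u <> x & lp_norm p (u - x) < e]]).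

(* The body of limf_esup, which cannot be applied to nat -> R since it requires
   the domain to carry a filteredType structure. *)
Definition limsup (R : realType) (T : Type) (f : T -> \bar R)
    (F : set (set T)) : \bar R :=
  ereal_inf [set ereal_sup (f @` V) | V in F].

(* For a in l_q and b in l_p with conjugate exponents the series converges
   absolutely, by Hoelder. *)
Definition pairing (R : realType) (a b : R^nat) : R :=
  limn (series (fun n => a n * b n)).

Definition duality (R : realType) (p : R) (x : R^nat) : R^nat :=
  if `[< x = 0 >] then 0
  else fun n => `|x n| `^ (p - 1) * Num.sg (x n) / lp_norm p x `^ (p - 2).

Definition supp (R : realType) (x : R^nat) : set nat := [set n | x n != 0].

(* For f : l_p -> l_q and w in l_p = (l_q)^*; the value is empty when (x, y)
   is not on the graph of f. *)
Definition coderivative (R : realType) (p q : R) (f : R^nat -> R^nat)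
    (x y w : R^nat) : set (R^nat) :=
  [set z | [/\ lp q z, y = f x &
    (limsup (fun u : R^nat =>
        ((pairing z (u - x) - pairing w (f u - f x)) /
         (lp_norm p (u - x) + lp_norm q (f u - f x)))%:E)
      (lp_dnbhs p x) <= 0)%E]].

(* Taken in \bar R, so that the infimum of the empty set is +oo. *)
Definition covering_constant (R : realType) (p q : R) (f : R^nat -> R^nat)
    (xbar ybar : R^nat) : \bar R :=
  ereal_sup [set ereal_inf
      [set t : \bar R | exists x y w z : R^nat,
        [/\ lp_closed_ball p xbar eta x,
            y = f x /\ lp_closed_ball q ybar eta y,
            lp p w /\ lp_norm p w = 1,
            coderivative p q f x y w z &
            t = (lp_norm q z)%:E]]
    | eta in [set eta : R | 0 < eta]].

(* Main.v *)
Require Import Defs.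
From mathcomp Require Import all_boot all_order all_algebra.
From mathcomp Require Import all_classical all_reals all_analysis.
From mathcomp Require Import lra.

(** At [xbar] itself the derivative in the direction of a basis vector [e_m]
with [m] outside the support of [xbar] degenerates.  The [m]-th coordinate of
[J u] is [|u_m|^(p-1) sign(u_m) / ||u||^(p-2)], and it vanishes at [xbar].
Since [p - 1 > 1] and [||u||] stays away from [0] near [xbar <> 0], it is
[o(|u_m|)], hence [o(||u - xbar||)].  So [z = 0] belongs to the coderivative of
[J] at [xbar] applied to the unit vector [e_m] ([coderivative_duality_delta]):
every infimum in the covering constant is at most [||0|| = 0], while it is
nonnegative because it ranges over norms.  The finiteness of the support is
what provides the free index [m].

The estimates compare coordinates with norms only, through
[|x_k| <= ||x||_p] ([ler_coord_lp_norm]).  In particular the lower bound of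
[||u||] near [xbar] comes from one nonzero coordinate [k] of [xbar]. *)

Set Implicit Arguments.
Unset Strict Implicit.
Unset Printing Implicit Defensive.
Import Order.TTheory GRing.Theory Num.Theory.

Local Open Scope classical_set_scope.
Local Open Scope ring_scope.

Lemma lpP (R : realType) (p : R) (x : R^nat) :
  lp p x <-> ('N[@counting nat R]_(p%:E)[EFin \o x] < +oo)%E.
Proof.
rewrite /lp /=; split=> [/andP[_]|xfin]; first by rewrite inE.
apply/andP; split; last by rewrite inE.
by apply/mem_set => /= _ A _.
Qed.

Lemma lp_norm_ge0 (R : realType) (p : R) (x : R^nat) : 0 <= lp_norm p x.
Proof. by rewrite fine_ge0// Lnorm_ge0. Qed.

Lemma Lnorm_counting0 (R : realType) (p : R) : 0 < p ->
  ('N[@counting nat R]_(p%:E)[EFin \o (0 : R^nat)%R] = 0)%E.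
Proof. by move=> p0; apply: (@Lnorm0 _ _ R); rewrite eqe gt_eqF. Qed.

Lemma lp0 (R : realType) (p : R) : 0 < p -> lp p (0 : R^nat).
Proof. by move=> p0; apply/lpP; rewrite Lnorm_counting0. Qed.

Lemma lp_norm0 (R : realType) (p : R) : 0 < p -> lp_norm p (0 : R^nat) = 0.
Proof. by move=> p0; rewrite /lp_norm Lnorm_counting0. Qed.

Lemma lpB (R : realType) (p : R) (x y : R^nat) :
  1 <= p -> lp p x -> lp p y -> lp p (x - y).
Proof.
move=> p1 xp yp.
have p1E : (1 <= p%:E)%E by rewrite lee_fin.
have [_ addC] := Lfun_addr_closed (@counting nat R) p1E.
by apply: addC => //; exact: Lfun_oppr_closed.
Qed.

Lemma ler_coord_lp_norm (R : realType) (p : R) (x : R^nat) (k : nat) :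
  0 < p -> lp p x -> `|x k| <= lp_norm p x.
Proof.
move=> p0 /lpP xfin; rewrite -lee_fin /lp_norm fineK; last first.
  by rewrite ge0_fin_numE ?Lnorm_ge0.
rewrite Lnorm_counting//= (@nneseriesD1 _ _ k)//.
have -> : (`|x k|%:E = ((`|x k| `^ p)%R)%:E `^ p^-1)%E.
  by rewrite poweR_EFin -powRrM mulfV ?gt_eqF// powRr1.
apply: gt0_ler_poweR; rewrite ?invr_ge0 ?(ltW p0)//.
- by rewrite in_itv/= leey lee_fin powR_ge0.
- rewrite in_itv/= leey andbT adde_ge0 ?lee_fin ?powR_ge0//.
  by rewrite nneseries_ge0.
- by rewrite leeDl// nneseries_ge0.
Qed.

Definition delta (R : realType) (m : nat) : R^nat := fun n => (n == m)%:R.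

Lemma Lnorm_counting_delta (R : realType) (p : R) (m : nat) : 0 < p ->
  ('N[@counting nat R]_(p%:E)[EFin \o delta R m] = 1)%E.
Proof.
move=> p0; rewrite Lnorm_counting//= (@nneseriesD1 _ _ m)//.
rewrite eseries0 ?adde0/delta ?eqxx ?normr1 ?powR1 ?poweR1r//.
by move=> i _ /= /negbTE ->; rewrite normr0 powR0 ?gt_eqF.
Qed.

Lemma pairing0l (R : realType) (b : R^nat) : pairing 0 b = 0.
Proof.
apply: norm_lim_near_cst => //; apply: nearW => n.
by rewrite /series /= big1// => i _; rewrite mul0r.
Qed.

Lemma pairing_delta (R : realType) (m : nat) (b : R^nat) :
  pairing (delta R m) b = b m.
Proof.
apply: norm_lim_near_cst => //; exists m.+1 => // n /= mn.
rewrite /series /= big_mkord (bigD1 (Ordinal mn))//= /delta eqxx mul1r.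
rewrite big1 ?addr0// => i; rewrite -val_eqE /= => /negbTE ->.
by rewrite mul0r.
Qed.

Lemma duality_eq0 (R : realType) (p : R) (x : R^nat) (m : nat) :
  x m = 0 -> duality p x m = 0.
Proof.
by move=> xm; rewrite /duality; case: asboolP => // _; rewrite xm sgr0 mulr0 mul0r.
Qed.

(** The factor [(|x_m| / ||x||)^(p-2)] is what [J] gains over a linear map; it
tends to [0] with [x_m] as long as [||x||] does not. *)
Lemma ler_norm_duality (R : realType) (p : R) (x : R^nat) (m : nat) :
  2 < p -> `|duality p x m| <= `|x m| * (`|x m| / lp_norm p x) `^ (p - 2).
Proof.
move=> p2; have [xm|xm] := eqVneq (x m) 0.
  by rewrite duality_eq0// xm normr0 mul0r.
rewrite /duality; case: asboolP => [x0|_]; first by rewrite x0 eqxx in xm.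
have n0 := lp_norm_ge0 p x.
have invpow : (lp_norm p x)^-1 `^ (p - 2) = (lp_norm p x `^ (p - 2))^-1.
  by rewrite -powR_inv1// powRAC powR_inv1 ?powR_ge0.
rewrite !normrM normr_sg xm mulr1 normfV !(ger0_norm (powR_ge0 _ _)).
rewrite powRM ?invr_ge0// invpow mulrA.
rewrite (_ : p - 2 = p - 1 - 1); last by lra.
by rewrite mulr_powRB1// subr_gt0; lra.
Qed.

(** Superlinearity of [J] in a coordinate where [x] vanishes.  Within distance
[d <= |x_k| / 2] of [x] one has [||u|| >= |u_k| >= |x_k| / 2] and
[|u_m| <= ||u - x|| < d], so [d] only has to be so small that
[(2 d / |x_k|)^(p-2) <= e]. *)
Lemma duality_coord_flat (R : realType) (p e : R) (x : R^nat) (k m : nat) :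
  2 < p -> lp p x -> x k != 0 -> x m = 0 -> 0 < e ->
  exists2 d, 0 < d & forall u, lp p u -> lp_norm p (u - x) < d ->
    `|duality p u m| <= e * lp_norm p (u - x).
Proof.
move=> p2 xp xk xm e0; pose c := `|x k| / 2.
have c0 : 0 < c by rewrite divr_gt0// normr_gt0.
exists (Num.min c (c * e `^ (p - 2)^-1)).
  by rewrite lt_min c0 mulr_gt0// powR_gt0.
move=> u up; rewrite lt_min => /andP[uxc uxe].
have p0 : 0 < p by lra.
have uxp : lp p (u - x) by apply: lpB => //; lra.
have coordB i : `|u i - x i| <= lp_norm p (u - x).
  exact: (ler_coord_lp_norm i p0 uxp).
have um : `|u m| <= lp_norm p (u - x) by have := coordB m; rewrite xm subr0.
have cu : c <= lp_norm p u.
  apply: le_trans (ler_coord_lp_norm k p0 up).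
  have := coordB k; rewrite distrC.
  have := lerB_dist (x k) (u k).
  by rewrite /c in uxc *; lra.
apply: le_trans (ler_norm_duality u m p2) _.
rewrite mulrC ler_pM ?powR_ge0//.
have -> : e = (e `^ (p - 2)^-1) `^ (p - 2).
  by rewrite -powRrM mulVf ?powRr1 ?(ltW e0)// subr_eq0 gt_eqF.
apply: ge0_ler_powR; rewrite ?nnegrE ?divr_ge0 ?lp_norm_ge0 ?powR_ge0//.
  by lra.
rewrite ler_pdivrMr ?(lt_le_trans c0)// (le_trans um)//.
apply: le_trans (ltW uxe) _.
by rewrite mulrC ler_wpM2l ?powR_ge0.
Qed.

Lemma limsup_le0 (R : realType) (p : R) (x : R^nat) (f : R^nat -> R) :
  (forall e, 0 < e -> exists2 d, 0 < d & forall u,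
    lp p u -> lp_norm p (u - x) < d -> f u <= e) ->
  (limsup (fun u => (f u)%:E) (lp_dnbhs p x) <= 0)%E.
Proof.
move=> fsmall; apply/lee_addgt0Pr => e e0; rewrite add0e.
have [d d0 fd] := fsmall e e0.
pose V := [set u | [/\ lp p u, u <> x & lp_norm p (u - x) < d]].
apply: (@le_trans _ _ (ereal_sup ((fun u => (f u)%:E) @` V))).
  by apply: ereal_inf_lbound; exists V => //; exists d.
apply: ge_ereal_sup => _ [u [up _ ux] <-].
by rewrite lee_fin fd.
Qed.

Lemma coderivative_duality_delta (R : realType) (p q : R) (x : R^nat)
    (k m : nat) :
  2 < p -> 0 < q -> lp p x -> x k != 0 -> x m = 0 ->
  coderivative p q (duality p) x (duality p x) (delta R m) 0.
Proof.
move=> p2 q0 xp xk xm; split => //; first exact: lp0.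
apply: limsup_le0 => e e0.
have [d d0 flat] := duality_coord_flat p2 xp xk xm e0.
exists d => // u up uxd.
rewrite pairing0l pairing_delta sub0r.
rewrite -[(_ - _) m]/(duality p u m - duality p x m) (duality_eq0 p xm) subr0.
set D := _ + _.
have xD : lp_norm p (u - x) <= D by rewrite lerDl lp_norm_ge0.
have D0 : 0 <= D by rewrite (le_trans _ xD)// lp_norm_ge0.
(* If [D = 0] the quotient is [0], because [0^-1 = 0]. *)
have [->|Dneq0] := eqVneq D 0; first by rewrite invr0 mulr0 ltW.
rewrite ler_pdivrMr ?lt_neqAle 1?eq_sym ?Dneq0//.
apply: le_trans (_ : e * lp_norm p (u - x) <= _); last by rewrite ler_wpM2l// ltW.
by apply: le_trans (flat u up uxd); rewrite -normrN ler_norm.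
Qed.

Theorem theorem5p2 (R : realType) (p q : R) (xbar ybar : R^nat) :
  2 < p -> p^-1 + q^-1 = 1 ->
  lp p xbar -> xbar <> 0 -> finite_set (supp xbar) ->
  lp q ybar -> ybar = duality p xbar ->
  covering_constant p q (duality p) xbar ybar = 0%E.
Proof.
move=> p2 pq xp x0 finx yq yE.
have p0 : 0 < p by lra.
have q0 : 0 < q.
  rewrite -invr_gt0 -(addKr p^-1 q^-1) pq addrC subr_gt0 invf_lt1//; lra.
have [k xk] : exists k, xbar k != 0.
  apply: contrapT => /forallNP xk; apply: x0; apply/funext => k.
  by apply/eqP; have /negP := xk k; rewrite negbK.
have [m xm] : exists m, xbar m = 0.
  apply: contrapT => /forallNP xm; apply: infinite_nat.
  by apply: sub_finite_set finx => n _; apply/eqP; exact: xm.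
have inf0 eta : 0 < eta -> ereal_inf
    [set t : \bar R | exists x y w z : R^nat,
      [/\ lp_closed_ball p xbar eta x,
          y = duality p x /\ lp_closed_ball q ybar eta y,
          lp p w /\ lp_norm p w = 1,
          coderivative p q (duality p) x y w z &
          t = (lp_norm q z)%:E]] = 0%E.
  move=> eta0; apply/eqP; rewrite eq_le; apply/andP; split; last first.
    apply: le_ereal_inf_tmp => _ [x [y [w [z [_ _ _ _ ->]]]]].
    by rewrite lee_fin lp_norm_ge0.
  apply: ereal_inf_lbound; exists xbar, ybar, (delta R m), 0.
  split.
  - by split => //; rewrite subrr lp_norm0// ltW.
  - by do 2 split => //; rewrite subrr lp_norm0// ltW.
  - split; first by apply/lpP; rewrite Lnorm_counting_delta// ltry.
    by rewrite /lp_norm Lnorm_counting_delta.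
  - by rewrite yE; exact: (coderivative_duality_delta p2 q0 xp xk xm).
  - by rewrite lp_norm0.
rewrite /covering_constant (_ : [set _ | _ in _] = [set 0%E]) ?ereal_sup1//.
apply/seteqP; split => [_ [eta /= eta0 <-]|_ ->]; first exact: inf0.
by exists 1; rewrite /= ?inf0.
Qed.
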